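(* Let $K\ge1$ and let $\bar\ell:\mathbb{R}^K\to\mathbb{R}$ be the multinomial logistic loss associated with a choice vector $(y_0,y_1,\dots,y_K)\in\{0,1\}^{K+1}$, $\sum_{i=0}^Ky_i=1$. Then $\bar\ell$ is $3\sqrt2$-self-concordant-like with respect to the $\ell_\infty$-norm: for all $\mathbf{a},\mathbf{b}\in\mathbb{R}^K$, the function $\phi(s)=\bar\ell(\mathbf{a}+s\mathbf{b})$ satisfies $$|\phi'''(s)|\le3\sqrt2\,\|\mathbf{b}\|_\infty\,\phi''(s)\qquad\text{for all }s\in\mathbb{R}.$$
   Context: The multinomial logistic loss with outside option $0$ is $\bar\ell(\mathbf{z})=-\sum_{i=0}^{K}y_i\log\left(\frac{\exp(z_i)}{1+\sum_{j=1}^K\exp(z_j)}\right)$ for $\mathbf{z}=(z_1,\dots,z_K)\in\mathbb{R}^K$, with the convention $z_0=0$. *)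

(* Defs.v *)
From HB Require Import structures.
From mathcomp Require Import all_boot all_order all_algebra.
From mathcomp Require Import all_classical all_reals all_analysis.

Set Implicit Arguments.
Unset Strict Implicit.
Unset Printing Implicit Defensive.

Import Order.TTheory GRing.Theory Num.Theory.
Import numFieldNormedType.Exports.

Local Open Scope ring_scope.

(* (z_0, z_1, ..., z_K) with the convention z_0 = 0: z_(j+1) is stored
   as z ord0 j, for j : 'I_K. *)
Definition logit (R : realType) (K : nat) (z : 'rV[R]_K) (i : 'I_K.+1) : R :=
  if unlift ord0 i is Some j then z ord0 j else 0.

Definition mnl_loss (R : realType) (K : nat) (y : 'I_K.+1 -> R)
    (z : 'rV[R]_K) : R :=
  - \sum_(i < K.+1)
      y i * ln (expR (logit z i) / (1 + \sum_(j < K) expR (z ord0 j))).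

(* derive1n is total, so the existence of the first three derivatives of phi,
   implicit in writing phi''' and phi'', is required explicitly. *)
Definition self_concordant_like (R : realType) (V : lmodType R)
    (N : V -> R) (M : R) (f : V -> R) : Prop :=
  forall a b : V, let phi := fun s : R => f (a + s *: b) in
    (forall (n : nat) (s : R), (n < 3)%N -> derivable (derive1n n phi) s 1) /\
    (forall s : R, `|derive1n 3 phi s| <= M * N b * derive1n 2 phi s).

(* Main.v *)
Require Import Defs.
From mathcomp Require Import all_boot all_order all_algebra.
From mathcomp Require Import all_classical all_reals all_analysis.
From mathcomp Require Import ring lra.

Import Order.TTheory GRing.Theory Num.Theory.
Import numFieldNormedType.Exports.

Local Open Scope ring_scope.

(** Along the line [a + s b] the loss is, up to an affine function of [s], the
    log-partition function of the softmax distribution with weights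
    [exp (a_i + s b_i)]. Hence [phi''] and [phi'''] are the variance and the
    third central moment of [b] under that distribution. Every [b_i] and their
    mean lie in [[-|b|, |b|]], so [|phi'''| <= 2 |b| phi''], and
    [2 <= 3 sqrt 2]. *)

(** The [k]-th derivative in [s] of the partition function [expsum u v 0]. *)
Definition expsum {R : realType} {n : nat} (u v : 'I_n -> R) (k : nat) (s : R)
    : R :=
  \sum_(i < n) v i ^+ k * expR (u i + s * v i).

Definition softmax {R : realType} {n : nat} (u v : 'I_n -> R) (s : R)
    (i : 'I_n) : R :=
  expR (u i + s * v i) / expsum u v 0 s.

Definition moment {R : realType} {n : nat} (u v : 'I_n -> R) (k : nat) (s : R)
    : R :=
  expsum u v k s / expsum u v 0 s.

Lemma is_derive_affine {R : realType} (c d s : R) :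
  is_derive s 1 (fun t : R => c + t * d) d.
Proof.
apply: is_derive_eq (is_deriveD (is_derive_cst c s 1)
  (is_deriveM (is_derive_id s 1) (is_derive_cst d s 1))) _.
by rewrite add0r scaler0 add0r /GRing.scale /= mulr1.
Qed.

Lemma is_derive_expsum {R : realType} {n : nat} (u v : 'I_n -> R) k (s : R) :
  is_derive s 1 (expsum u v k) (expsum u v k.+1 s).
Proof.
(* The derivative rule for sums expects a sum of functions, not a function whose values are sums. *)
have -> : expsum u v k = \sum_(i < n) (fun t => v i ^+ k * expR (u i + t * v i)).
  by apply/funext => t; rewrite fct_sumE.
apply: is_derive_sum => i.
have he := @is_derive1_comp R expR _ s _ _ (is_derive_expR _)
  (is_derive_affine (u i) (v i) s).
apply: is_derive_eq (is_deriveZ (v i ^+ k) he) _.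
by rewrite /GRing.scale /= exprSr; ring.
Qed.

Lemma expsum0_gt0 {R : realType} {n : nat} (u v : 'I_n.+1 -> R) (s : R) :
  0 < expsum u v 0 s.
Proof.
rewrite /expsum big_ord_recl expr0 mul1r ltr_pwDl ?expR_gt0 //.
by apply: sumr_ge0 => i _; rewrite expr0 mul1r expR_ge0.
Qed.

(** Quotient rule: differentiating the numerator raises the order by one, and differentiating the
    normaliser [expsum u v 0] brings out a factor [moment u v 1 s]. *)
Lemma is_derive_moment {R : realType} {n : nat} (u v : 'I_n.+1 -> R) k (s : R) :
  is_derive s 1 (moment u v k)
    (moment u v k.+1 s - moment u v k s * moment u v 1 s).
Proof.
have S0 : expsum u v 0 s != 0 by rewrite gt_eqF ?expsum0_gt0.
have hV := is_deriveV S0 (is_derive_expsum u v 0 s).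
apply: is_derive_eq (is_deriveM (is_derive_expsum u v k s) hV) _.
by rewrite /moment /GRing.scale /=; field.
Qed.

Lemma is_derive_ln_expsum {R : realType} {n : nat} (u v : 'I_n.+1 -> R)
    (s : R) :
  is_derive s 1 (fun t => ln (expsum u v 0 t)) (moment u v 1 s).
Proof.
have := @is_derive1_comp R (@ln R) _ s _ _ (is_derive1_ln (expsum0_gt0 u v s))
  (is_derive_expsum u v 0 s).
by rewrite mulrC.
Qed.

Lemma is_derive_variance {R : realType} {n : nat} (u v : 'I_n.+1 -> R)
    (s : R) :
  is_derive s 1 (fun t => moment u v 2 t - moment u v 1 t * moment u v 1 t)
    (moment u v 3 s - 3 * moment u v 2 s * moment u v 1 s
     + 2 * moment u v 1 s ^+ 3).
Proof.
have h1 := is_derive_moment u v 1 s; have h2 := is_derive_moment u v 2 s.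
apply: is_derive_eq (is_deriveB h2 (is_deriveM h1 h1)) _.
by rewrite /GRing.scale /=; ring.
Qed.

Lemma momentE {R : realType} {n : nat} (u v : 'I_n -> R) k (s : R) :
  moment u v k s = \sum_(i < n) softmax u v s i * v i ^+ k.
Proof.
by rewrite /moment mulr_suml; apply: eq_bigr => i _; rewrite /softmax; ring.
Qed.

Lemma sum_softmax {R : realType} {n : nat} (u v : 'I_n.+1 -> R) (s : R) :
  \sum_(i < n.+1) softmax u v s i = 1.
Proof.
(* The total mass is the moment of order 0, so 1 is rewritten as that quotient. *)
rewrite -[RHS](@divff _ (expsum u v 0 s)) ?gt_eqF ?expsum0_gt0 //.
rewrite -/(moment u v 0 s) momentE.
by apply: eq_bigr => i _; rewrite expr0 mulr1.
Qed.

Section CentralMoments.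
Context {R : realType} {n : nat} (p v : 'I_n -> R) (B : R).
Hypotheses (p_ge0 : forall i, 0 <= p i) (sum_p : \sum_(i < n) p i = 1).
Hypothesis (v_le : forall i, `|v i| <= B).

Let m k := \sum_(i < n) p i * v i ^+ k.

Lemma variance_central :
  m 2 - m 1 * m 1 = \sum_(i < n) p i * (v i - m 1) ^+ 2.
Proof.
(* The square is expanded with [v i ^+ 1] left unsimplified, so that each sum folds back into some
   [m k]. *)
rewrite (eq_bigr (fun i => p i * v i ^+ 2 - 2 * m 1 * (p i * v i ^+ 1)
  + m 1 ^+ 2 * p i)); last by move=> i _; ring.
by rewrite big_split /= sumrB -!mulr_sumr sum_p -/(m 1) -/(m 2); ring.
Qed.

Lemma skewness_central :
  m 3 - 3 * m 2 * m 1 + 2 * m 1 ^+ 3 = \sum_(i < n) p i * (v i - m 1) ^+ 3.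
Proof.
rewrite (eq_bigr (fun i => p i * v i ^+ 3 - 3 * m 1 * (p i * v i ^+ 2)
  + 3 * m 1 ^+ 2 * (p i * v i ^+ 1) - m 1 ^+ 3 * p i)); last first.
  by move=> i _; ring.
rewrite sumrB big_split /= sumrB -!mulr_sumr sum_p.
by rewrite -/(m 1) -/(m 2) -/(m 3); ring.
Qed.

Lemma norm_mean_le : `|m 1| <= B.
Proof.
apply: le_trans (ler_norm_sum _ _ _) _; rewrite -[B]mul1r -sum_p mulr_suml.
by apply: ler_sum => i _; rewrite expr1 normrM ger0_norm // ler_wpM2l.
Qed.

(** The two central sums are compared term by term: one factor of the cube is at most
    [|v i| + |m 1| <= 2 * B], and the remaining square is nonnegative. *)
Lemma skewness_le_variance :
  `|m 3 - 3 * m 2 * m 1 + 2 * m 1 ^+ 3| <= 2 * B * (m 2 - m 1 * m 1).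
Proof.
rewrite skewness_central variance_central mulr_sumr.
apply: le_trans (ler_norm_sum _ _ _) _; apply: ler_sum => i _.
rewrite normrM ger0_norm // mulrCA ler_wpM2l // exprS normrM.
rewrite [`|_ ^+ 2|]ger0_norm ?sqr_ge0 // ler_wpM2r ?sqr_ge0 //.
apply: le_trans (ler_normB _ _) _.
by rewrite mulr_natl mulr2n lerD ?norm_mean_le.
Qed.

Lemma variance_ge0 : 0 <= m 2 - m 1 * m 1.
Proof.
by rewrite variance_central sumr_ge0 // => i _; rewrite mulr_ge0 ?sqr_ge0.
Qed.

End CentralMoments.

Lemma norm_logit_le {R : realType} {K : nat} (b : 'rV[R]_K) i :
  `|logit b i| <= `|b|.
Proof.
rewrite /logit; case: unliftP => [j _|_]; last by rewrite normr0.
rewrite [leRHS]mx_normrE.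
exact: (le_bigmax _ (fun ij => `|b ij.1 ij.2|) (ord0, j)).
Qed.

Lemma logit_line {R : realType} {K : nat} (a b : 'rV[R]_K) (s : R) i :
  logit (a + s *: b) i = logit a i + s * logit b i.
Proof.
by rewrite /logit; case: unlift => [j|]; rewrite ?mxE // mulr0 addr0.
Qed.

(** The 1 in the denominator is the exponential of the zero logit of the outside option, so the
    denominator is a full partition function. Its logarithm gets coefficient 1 because the [y i] sum
    to 1. *)
Lemma mnl_loss_line {R : realType} {K : nat} (y : 'I_K.+1 -> R)
    (a b : 'rV[R]_K) (s : R) :
  \sum_(i < K.+1) y i = 1 ->
  mnl_loss y (a + s *: b) =
    ln (expsum (logit a) (logit b) 0 s)
    - (\sum_(i < K.+1) y i * logit a i + s * \sum_(i < K.+1) y i * logit b i).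
Proof.
move=> y1; rewrite /mnl_loss.
have -> : 1 + \sum_(j < K) expR ((a + s *: b) ord0 j)
    = expsum (logit a) (logit b) 0 s.
  rewrite /expsum big_ord_recl expr0 mul1r -logit_line {1}/logit unlift_none.
  rewrite expR0; congr (_ + _); apply: eq_bigr => j _.
  by rewrite expr0 mul1r -logit_line /logit liftK.
have S0 := expsum0_gt0 (logit a) (logit b) s.
set S := expsum _ _ _ _ in S0 *.
rewrite (eq_bigr (fun i => y i * logit a i + s * (y i * logit b i)
  - ln S * y i)).
  by rewrite sumrB big_split /= -!mulr_sumr y1; ring.
move=> i _; rewrite ln_div ?posrE ?expR_gt0 // expRK logit_line; ring.
Qed.

(* On 'rV[R]_K, the norm `|b| is the maximum of the `|b ord0 j|. *)
Theorem propositionB3 (R : realType) (K : nat) (hK : (1 <= K)%N)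
    (y : 'I_K.+1 -> R) (hy : forall i, y i = 0 \/ y i = 1)
    (hsum : \sum_(i < K.+1) y i = 1) :
  self_concordant_like (fun b : 'rV[R]_K => `|b|) (3 * Num.sqrt 2)
    (mnl_loss y).
Proof.
move=> a b phi; pose M := moment (logit a) (logit b).
pose d := \sum_(i < K.+1) y i * logit b i.
have D1 (s : R) : is_derive s 1 phi (M 1 s - d).
  rewrite /phi (funext (fun t => mnl_loss_line y a b t hsum)) -/d.
  exact: is_deriveB (is_derive_ln_expsum _ _ s) (is_derive_affine _ d s).
have E1 : derive1n 1 phi = (fun s => M 1 s - d).
  by apply/funext => s; rewrite derive1n1 derive1E derive_val.
have D2 (s : R) : is_derive s 1 (derive1n 1 phi) (M 2 s - M 1 s * M 1 s).
  rewrite E1; apply: is_derive_eq (is_deriveB (is_derive_moment _ _ 1 s) _) _.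
  by rewrite subr0.
have E2 : derive1n 2 phi = (fun s => M 2 s - M 1 s * M 1 s).
  by apply/funext => s; rewrite derive1nS derive1E derive_val.
have D3 (s : R) : is_derive s 1 (derive1n 2 phi)
    (M 3 s - 3 * M 2 s * M 1 s + 2 * M 1 s ^+ 3).
  by rewrite E2; exact: is_derive_variance.
split=> [[|[|[|//]]] s _|s].
- exact: ex_derive.
- exact: ex_derive.
- exact: ex_derive.
rewrite derive1nS derive1E derive_val E2 /M !momentE.
have p_ge0 i : 0 <= softmax (logit a) (logit b) s i.
  by rewrite divr_ge0 ?expR_ge0 // ltW ?expsum0_gt0.
have sum_p := sum_softmax (logit a) (logit b) s.
apply: le_trans (skewness_le_variance _ _ _ p_ge0 sum_p (norm_logit_le b)) _.
(* Nonnegativity of the variance, then of the norm, reduces the goal to [2 <= 3 * Num.sqrt 2]. *)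
apply: ler_wpM2r; first exact: variance_ge0.
apply: ler_wpM2r => //.
have : 1 <= Num.sqrt (2 : R) by rewrite -[leLHS]sqrtr1 ler_sqrt ?ler1n.
lra.
Qed.
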